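(* Assume that there are a positive definite matrix $X\in\mathbb R^{n\times n}$, $\lambda>0$ and $\delta>0$ such that $$(1)\qquad LV_X(x,y;\delta)\le-\lambda V_X(x-y)\qquad\text{for all }x,y\in\mathbb R^n .$$ (i) If there is a constant $c>0$ such that $$(2)\qquad\|X^{1/2}(\Gamma(x)-\Gamma(y))\|_F\le c\,\|X^{1/2}(x-y)\|\qquad\text{for all }x,y\in\mathbb R^n,$$ then a (full) reachability Gramian $P$ exists. If (1) and (2) are only required for $y=0$ (and all $x\in\mathbb R^n$), then a simplified reachability Gramian $P$ exists. (ii) If there is a constant $c>0$ such that $$(3)\qquad\|h(x)-h(y)\|\le c\,\|X^{1/2}(x-y)\|\qquad\text{for all }x,y\in\mathbb R^n,$$ then a (full) observability Gramian $Q$ exists. If (1) and (3) are only required for $y=0$ (and all $x\in\mathbb R^n$), then a simplified observability Gramian $Q$ exists.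
   Context: Setting: $f,g_i,\gamma_j:\mathbb R^n\to\mathbb R^n$ ($i=1,\dots,m$, $j=1,\dots,q$) and $h:\mathbb R^n\to\mathbb R^p$ are functions with $f(0)=g_i(0)=\gamma_j(0)=0$, $h(0)=0$; $G(x)=[g_1(x)\ \cdots\ g_m(x)]$, $\Gamma(x)=[\gamma_1(x)\ \cdots\ \gamma_q(x)]$; $B\in\mathbb R^{n\times m}$, $M_j\in\mathbb R^{n\times m}$ ($j=1,\dots,q$), and $K=(k_{ij})_{i,j=1,\dots,q}$ is the (symmetric positive semidefinite) covariance matrix of an $\mathbb R^q$-valued Wiener process $w$, $\mathbb E[w(t)w(t)^\top]=Kt$. These are the coefficients of the controlled stochastic system $dx=[f(x)+Bu+G(x)u]dt+[\Gamma(x)+M(u)]dw$, $y=h(x)+Eu$, with $M(u)=[M_1u\ \cdots\ M_qu]$, $E\in\mathbb R^{p\times m}$; the coefficients are assumed regular enough for unique global solutions to exist. $\|\cdot\|$ is the Euclidean norm, $\|\cdot\|_F$ the Frobenius norm. Positive (semi)definite matrices are symmetric. For positive (semi)definite $X\in\mathbb R^{n\times n}$ put $V_X(x)=x^\top Xx$ and, for $\delta>0$, $$LV_X(x,y;\delta)=2\langle x-y,X(f(x)-f(y))\rangle+\delta^2\|X^{1/2}(G(x)-G(y))\|_F^2+\|X^{1/2}(\Gamma(x)-\Gamma(y))K^{1/2}\|_F^2 .$$ Let $\mathcal U\in\mathbb R^{m\times m}$ be a given positive definite matrix (a free parameter) and set $$U_X=\mathcal U-\sum_{i,j=1}^qM_i^\top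 XM_jk_{ij},\qquad S_X(x,y)=B^\top X(x-y)+\sum_{i,j=1}^qM_i^\top X(\gamma_j(x)-\gamma_j(y))k_{ij}.$$ Reachability Gramian: a positive definite $P\in\mathbb R^{n\times n}$ is a (full) reachability Gramian if $U_{P^{-1}}$ is positive definite and, for some $\delta>0$, $$LV_{P^{-1}}(x,y;\delta)\le-S_{P^{-1}}(x,y)^\top U_{P^{-1}}^{-1}S_{P^{-1}}(x,y)\quad\text{for all }x,y\in\mathbb R^n.$$ It is a simplified reachability Gramian if $U_{P^{-1}}$ is positive definite and the inequality is only required for $y=0$ and all $x$. Observability Gramian: a positive (semi)definite $Q\in\mathbb R^{n\times n}$ is a (full) observability Gramian if, for some $\delta>0$, $$LV_Q(x,y;\delta)\le-(h(x)-h(y))^\top(h(x)-h(y))\quad\text{for all }x,y\in\mathbb R^n,$$ and a simplified observability Gramian if this is only required for $y=0$ and all $x$. *)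

(* Defs.v *)
From HB Require Import structures.
From mathcomp Require Import all_boot all_order all_algebra.
From mathcomp Require Import boolp classical_sets reals.
Set Implicit Arguments.
Unset Strict Implicit.
Unset Printing Implicit Defensive.
Import Order.TTheory GRing.Theory Num.Theory.
Local Open Scope ring_scope.

(* Euclidean inner product and norm of column vectors; the canonical norm of
   MathComp-Analysis on matrices is the sup norm and is not used here. *)
Definition dotcv (R : realType) (n : nat) (u v : 'cV[R]_n) : R :=
  (u^T *m v) 0 0.

Definition enorm (R : realType) (n : nat) (u : 'cV[R]_n) : R :=
  Num.sqrt (dotcv u u).

Definition frobnorm (R : realType) (m n : nat) (A : 'M[R]_(m, n)) : R :=
  Num.sqrt (\sum_(i < m) \sum_(j < n) A i j ^+ 2).

Definition posdefmx (R : realType) (n : nat) (A : 'M[R]_n) : Prop :=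
  A^T = A /\ forall x : 'cV[R]_n, x != 0 -> 0 < dotcv x (A *m x).

Definition possemidefmx (R : realType) (n : nat) (A : 'M[R]_n) : Prop :=
  A^T = A /\ forall x : 'cV[R]_n, 0 <= dotcv x (A *m x).

(* A^{1/2}: the positive semidefinite S with S^2 = A, which exists and is
   unique when A is positive semidefinite (junk value 0 otherwise). *)
Definition sqrtmx (R : realType) (n : nat) (A : 'M[R]_n) : 'M[R]_n :=
  xget 0 [set S : 'M[R]_n | possemidefmx S /\ S *m S = A]%classic.

(* [v_1(x) ... v_k(x)], so that G = colsmx g and Gamma = colsmx gamma. *)
Definition colsmx (R : realType) (n k : nat)
    (v : 'I_k -> 'cV[R]_n -> 'cV[R]_n) (x : 'cV[R]_n) : 'M[R]_(n, k) :=
  \matrix_(i < n, j < k) v j x i 0.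

Definition quadV (R : realType) (n : nat) (X : 'M[R]_n) (x : 'cV[R]_n) : R :=
  (x^T *m X *m x) 0 0.

Definition LV (R : realType) (n m q : nat) (f : 'cV[R]_n -> 'cV[R]_n)
    (g : 'I_m -> 'cV[R]_n -> 'cV[R]_n)
    (gamma : 'I_q -> 'cV[R]_n -> 'cV[R]_n) (K : 'M[R]_q)
    (X : 'M[R]_n) (delta : R) (x y : 'cV[R]_n) : R :=
  2 * dotcv (x - y) (X *m (f x - f y))
  + delta ^+ 2 * frobnorm (sqrtmx X *m (colsmx g x - colsmx g y)) ^+ 2
  + frobnorm (sqrtmx X *m (colsmx gamma x - colsmx gamma y) *m sqrtmx K) ^+ 2.

(* [U0] is the free positive definite parameter (calligraphic U). *)
Definition Umx (R : realType) (n m q : nat) (M : 'I_q -> 'M[R]_(n, m))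
    (K : 'M[R]_q) (U0 : 'M[R]_m) (X : 'M[R]_n) : 'M[R]_m :=
  U0 - \sum_(i < q) \sum_(j < q) K i j *: ((M i)^T *m X *m M j).

Definition Svec (R : realType) (n m q : nat)
    (gamma : 'I_q -> 'cV[R]_n -> 'cV[R]_n) (B : 'M[R]_(n, m))
    (M : 'I_q -> 'M[R]_(n, m)) (K : 'M[R]_q) (X : 'M[R]_n)
    (x y : 'cV[R]_n) : 'cV[R]_m :=
  B^T *m X *m (x - y)
  + \sum_(i < q) \sum_(j < q)
      K i j *: ((M i)^T *m X *m (gamma j x - gamma j y)).

Definition reach_ineq (R : realType) (n m q : nat) (f : 'cV[R]_n -> 'cV[R]_n)
    (g : 'I_m -> 'cV[R]_n -> 'cV[R]_n)
    (gamma : 'I_q -> 'cV[R]_n -> 'cV[R]_n) (B : 'M[R]_(n, m))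
    (M : 'I_q -> 'M[R]_(n, m)) (K : 'M[R]_q) (U0 : 'M[R]_m)
    (P : 'M[R]_n) (delta : R) (x y : 'cV[R]_n) : Prop :=
  let S := Svec gamma B M K (invmx P) x y in
  LV f g gamma K (invmx P) delta x y
    <= - (S^T *m invmx (Umx M K U0 (invmx P)) *m S) 0 0.

Definition reachability_gramian (R : realType) (n m q : nat)
    (f : 'cV[R]_n -> 'cV[R]_n) (g : 'I_m -> 'cV[R]_n -> 'cV[R]_n)
    (gamma : 'I_q -> 'cV[R]_n -> 'cV[R]_n) (B : 'M[R]_(n, m))
    (M : 'I_q -> 'M[R]_(n, m)) (K : 'M[R]_q) (U0 : 'M[R]_m)
    (P : 'M[R]_n) : Prop :=
  [/\ posdefmx P, posdefmx (Umx M K U0 (invmx P)) &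
    exists2 delta : R, 0 < delta &
      forall x y : 'cV[R]_n, reach_ineq f g gamma B M K U0 P delta x y].

Definition simplified_reachability_gramian (R : realType) (n m q : nat)
    (f : 'cV[R]_n -> 'cV[R]_n) (g : 'I_m -> 'cV[R]_n -> 'cV[R]_n)
    (gamma : 'I_q -> 'cV[R]_n -> 'cV[R]_n) (B : 'M[R]_(n, m))
    (M : 'I_q -> 'M[R]_(n, m)) (K : 'M[R]_q) (U0 : 'M[R]_m)
    (P : 'M[R]_n) : Prop :=
  [/\ posdefmx P, posdefmx (Umx M K U0 (invmx P)) &
    exists2 delta : R, 0 < delta &
      forall x : 'cV[R]_n, reach_ineq f g gamma B M K U0 P delta x 0].

Definition observability_gramian (R : realType) (n m p q : nat)
    (f : 'cV[R]_n -> 'cV[R]_n) (g : 'I_m -> 'cV[R]_n -> 'cV[R]_n)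
    (gamma : 'I_q -> 'cV[R]_n -> 'cV[R]_n) (h : 'cV[R]_n -> 'cV[R]_p)
    (K : 'M[R]_q) (Q : 'M[R]_n) : Prop :=
  possemidefmx Q /\
  exists2 delta : R, 0 < delta &
    forall x y : 'cV[R]_n,
      LV f g gamma K Q delta x y <= - dotcv (h x - h y) (h x - h y).

Definition simplified_observability_gramian (R : realType) (n m p q : nat)
    (f : 'cV[R]_n -> 'cV[R]_n) (g : 'I_m -> 'cV[R]_n -> 'cV[R]_n)
    (gamma : 'I_q -> 'cV[R]_n -> 'cV[R]_n) (h : 'cV[R]_n -> 'cV[R]_p)
    (K : 'M[R]_q) (Q : 'M[R]_n) : Prop :=
  possemidefmx Q /\
  exists2 delta : R, 0 < delta &
    forall x : 'cV[R]_n,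
      LV f g gamma K Q delta x 0 <= - dotcv (h x - h 0) (h x - h 0).

(* Main.v *)
Require Import Defs.
From HB Require Import structures.
From mathcomp Require Import all_boot all_order all_algebra.
From mathcomp Require Import boolp classical_sets reals.
From mathcomp Require Import complex sesquilinear spectral ring lra.
Set Implicit Arguments.
Unset Strict Implicit.
Unset Printing Implicit Defensive.
Import Order.TTheory GRing.Theory Num.Theory.
Local Open Scope ring_scope.

(** The Gramians can be taken to be multiples of [X] and of its inverse,
    because [LV] is linear in [X] under positive scaling ([LVZ]): for [t > 0],
    the decay hypothesis gives [LV_{tX} <= - t * lambda * V_X].

    For observability, take [Q = tX] with [t = c^2 / lambda]: the right-hand
    side becomes [- c^2 * V_X], and the growth bound on [h] says precisely that
    [|h x - h y|^2 <= c^2 * V_X (x - y)].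

    For reachability, take [P = (tX)^-1] with [t] small. The quadratic term
    [S^T U^-1 S] has order [t^2], since [S_{tX} = t * S_X] while
    [U_{tX} = U0 - t W], with [W] a fixed symmetric matrix, stays above half
    the coercivity constant of [U0]; and [|S_X|^2 <= C * V_X]
    ([Svec_dominated]), which is where the growth bound on [gamma] enters.
    For [t] small enough the available decay [t * lambda * V_X], of order [t],
    absorbs it.

    Each argument is pointwise in the pair [(x, y)], so it is carried out over
    an arbitrary set [D] of pairs; the full Gramians use all pairs and the
    simplified ones the pairs with [y = 0].

    The bounds are phrased with matrix square roots, so these must be shown to
    exist ([possemidef_sqrt]). The complex spectral theorem diagonalizes a
    real symmetric matrix [A] with real eigenvalues; hence a real polynomial
    vanishing on the spectrum annihilates [A], and the root is the square
    of [p(A)], where [p] interpolates the fourth root on the spectrum.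

    The same square roots give the coercivity of positive definite matrices,
    without appealing to compactness of the sphere ([posdef_coercive]). *)

(** * Euclidean geometry of column vectors *)

Section InnerProduct.
Variable R : realType.

Lemma dotcvE n (u v : 'cV[R]_n) : dotcv u v = \sum_i u i 0 * v i 0.
Proof. by rewrite /dotcv mxE; apply: eq_bigr => i _; rewrite mxE. Qed.

Lemma dotcvC n (u v : 'cV[R]_n) : dotcv u v = dotcv v u.
Proof. by rewrite !dotcvE; apply: eq_bigr => i _; rewrite mulrC. Qed.

Lemma dotcvDr n (u v w : 'cV[R]_n) : dotcv u (v + w) = dotcv u v + dotcv u w.
Proof. by rewrite /dotcv mulmxDr mxE. Qed.

Lemma dotcvZr n a (u v : 'cV[R]_n) : dotcv u (a *: v) = a * dotcv u v.
Proof. by rewrite /dotcv -scalemxAr mxE. Qed.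

Lemma dotcvDl n (u v w : 'cV[R]_n) : dotcv (v + w) u = dotcv v u + dotcv w u.
Proof. by rewrite !(dotcvC _ u) dotcvDr. Qed.

Lemma dotcvZl n a (u v : 'cV[R]_n) : dotcv (a *: u) v = a * dotcv u v.
Proof. by rewrite !(dotcvC _ v) dotcvZr. Qed.

Lemma dotcv_ge0 n (u : 'cV[R]_n) : 0 <= dotcv u u.
Proof. by rewrite dotcvE sumr_ge0 // => i _; rewrite -expr2 sqr_ge0. Qed.

Lemma dotcv_gt0 n (u : 'cV[R]_n) : u != 0 -> 0 < dotcv u u.
Proof.
move=> u0; rewrite lt_neqAle dotcv_ge0 andbT eq_sym; apply: contra u0.
rewrite dotcvE psumr_eq0 => [/allP u0|i _]; last by rewrite -expr2 sqr_ge0.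
apply/eqP/colP => i; rewrite mxE; apply/eqP.
by move: (u0 i (mem_index_enum i)) => /=; rewrite mulf_eq0 orbb.
Qed.

Lemma dotcv_mulmxl m n (A : 'M[R]_(m, n)) u v :
  dotcv (A *m u) v = dotcv u (A^T *m v).
Proof. by rewrite /dotcv trmx_mul mulmxA. Qed.

Lemma dotcv_sym_sqr n (S A : 'M[R]_n) u :
  S^T = S -> S *m S = A -> dotcv u (A *m u) = dotcv (S *m u) (S *m u).
Proof. by move=> SS <-; rewrite dotcv_mulmxl SS mulmxA. Qed.

Lemma quadVE n (X : 'M[R]_n) x : quadV X x = dotcv x (X *m x).
Proof. by rewrite /quadV /dotcv mulmxA. Qed.

Lemma enorm_sqr n (u : 'cV[R]_n) : enorm u ^+ 2 = dotcv u u.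
Proof. by rewrite /enorm sqr_sqrtr // dotcv_ge0. Qed.

Lemma frobnorm_sqr m n (A : 'M[R]_(m, n)) : frobnorm A ^+ 2 = \tr (A^T *m A).
Proof.
rewrite /frobnorm sqr_sqrtr; last first.
  by apply: sumr_ge0 => i _; apply: sumr_ge0 => j _; exact: sqr_ge0.
rewrite exchange_big; apply: eq_bigr => j _.
by rewrite !mxE; apply: eq_bigr => i _; rewrite mxE expr2.
Qed.

End InnerProduct.

(** * Square roots of positive semidefinite matrices *)

Lemma interpolation (F : fieldType) (f : F -> F) (s : seq F) :
  exists p : {poly F}, {in s, forall x, p.[x] = f x}.
Proof.
elim: s => [|a s [p ps]]; first by exists 0.
(* Newton's scheme: correct [p] at the new node [a] by a multiple of a
   polynomial vanishing at the old ones. *)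
have [as_|as_] := boolP (a \in s).
  by exists p => x; rewrite inE => /orP[/eqP->|]; exact: ps.
pose w : {poly F} := \prod_(r <- s) ('X - r%:P).
have wroot x : root w x = (x \in s).
  rewrite /w -(big_map idfun predT (fun r => 'X - r%:P)).
  by rewrite root_prod_XsubC map_id.
have wa : w.[a] != 0 by rewrite -rootE wroot.
exists (p + ((f a - p.[a]) / w.[a]) *: w) => x.
rewrite inE !hornerE => /orP[/eqP->|xs]; first by rewrite divfK // subrKC.
by have := wroot x; rewrite xs rootE => /eqP->; rewrite mulr0 addr0 ps.
Qed.

Section SquareRoot.
Variable R : realType.

Lemma trmx_horner (n : nat) (A : 'M[R]_n.+1) p :
  A^T = A -> (horner_mx A p)^T = horner_mx A p.
Proof.
move=> AA; elim/poly_ind: p => [|p c IH]; first by rewrite rmorph0 trmx0.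
rewrite rmorphD rmorphM /= horner_mx_X horner_mx_C linearD /= tr_scalar_mx.
rewrite -mulmxE trmx_mul IH AA; congr (_ + _).
exact/esym/comm_horner_mx/comm_mx_refl.
Qed.

(** The form of the real spectral theorem suited to functional calculus: two
    polynomials that agree on the real spectrum of [A] agree at [A]. *)
Lemma symmetric_diagonalizable (n : nat) (A : 'M[R]_n.+1) : A^T = A ->
  exists2 s : seq R, {in s, forall a, eigenvalue A a} &
    forall p : {poly R}, {in s, forall a, p.[a] = 0} -> horner_mx A p = 0.
Proof.
move=> AA; pose toC : {rmorphism R -> R[i]} := real_complex R.
pose Ac := map_mx toC A.
have Ah : Ac \is hermsymmx.
  apply: realsym_hermsym.
    apply/is_hermitianmxP/matrixP => i j.
    by rewrite expr0 scale1r !mxE -[in LHS]AA mxE.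
  by apply/mxOverP => i j; rewrite mxE; apply/complex_realP; exists (A i j).
pose P := spectralmx Ac; pose e := map_mx (@complex.Re R) (spectral_diag Ac).
have Pu : P \in unitmx by exact: spectral_unit.
have eC : spectral_diag Ac = map_mx toC e.
  apply/rowP => j; rewrite !mxE.
  have /mxOverP/(_ 0 j)/complex_realP[k ->] := hermitian_spectral_diag_real Ah.
  by [].
have /orthomx_spectralP := hermitian_normalmx Ah; rewrite -/P eC => Aeq.
exists [seq e 0 j | j <- enum 'I_n.+1] => [a /mapP[j _ ->]|p pe].
  (* A real number that is an eigenvalue over the complex numbers is one over
     the reals, both being roots of the same characteristic polynomial. *)
  rewrite eigenvalue_root_char -(fmorph_root toC) map_char_poly.
  rewrite -eigenvalue_root_char; apply/eigenvalueP; exists (row j P).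
    rewrite -/Ac Aeq !mulmxA -row_mul mulmxV // -row_mul mul1mx.
    by rewrite row_diag_mx -scalemxAl -rowE !mxE.
  apply/eqP => /(congr1 (fun v => v *m invmx P)).
  rewrite -row_mul mulmxV // mul0mx => /rowP/(_ j)/eqP.
  by rewrite !mxE eqxx oner_eq0.
apply: (@map_mx_inj _ _ toC); rewrite map_horner_mx -/Ac Aeq.
rewrite (horner_mx_uconjC _ _ Pu) horner_mx_diag.
have -> : map_mx (horner (map_poly toC p)) (map_mx toC e) = 0.
  apply/rowP => j; rewrite !mxE horner_map /= pe ?rmorph0 //.
  by apply/mapP; exists j; rewrite ?mem_enum ?mxE.
by rewrite linear0 mulmx0 mul0mx map_mx0.
Qed.

Lemma eigenvalue_possemidef n (A : 'M[R]_n) a :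
  possemidefmx A -> eigenvalue A a -> 0 <= a.
Proof.
move=> [AA Age0] /eigenvalueP[v vA v0].
have := Age0 v^T.
rewrite -{1}AA -trmx_mul vA linearZ /= dotcvZr pmulr_lge0 //.
by apply: dotcv_gt0; rewrite trmx_eq0.
Qed.

Lemma possemidef_sqrt n (A : 'M[R]_n) : possemidefmx A ->
  exists S : 'M[R]_n, possemidefmx S /\ S *m S = A.
Proof.
case: n A => [|n] A Apsd; first by exists A; split=> //; apply/matrixP => -[].
have [s eigs ann] := symmetric_diagonalizable Apsd.1.
have [p ps] := interpolation (fun a => Num.sqrt (Num.sqrt a)) s.
(* [C] is to be the fourth root of [A]; writing the square root as [C *m C]
   with [C] symmetric makes it visibly positive semidefinite. *)
pose C := horner_mx A p.
have CC : C^T = C by apply: trmx_horner; exact: Apsd.1.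
exists (C *m C); split; first split.
- by rewrite trmx_mul CC.
- by move=> x; rewrite (dotcv_sym_sqr _ CC erefl) dotcv_ge0.
apply/eqP; rewrite -subr_eq0 !mulmxE -!rmorphM /=.
rewrite -{2}(horner_mx_X A) -rmorphB /=.
apply/eqP/ann => a sa; have a0 := eigenvalue_possemidef Apsd (eigs _ sa).
rewrite hornerD hornerN !hornerM hornerX ps // -!expr2.
by rewrite !sqr_sqrtr ?sqrtr_ge0 // subrr.
Qed.

Lemma sqrtmxP n (A : 'M[R]_n) : possemidefmx A ->
  possemidefmx (sqrtmx A) /\ sqrtmx A *m sqrtmx A = A.
Proof. by move=> /possemidef_sqrt S; rewrite /sqrtmx; exact: xgetPex S. Qed.

End SquareRoot.
(** * Families of vectors bounded by a quadratic form *)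

Section Dominated.
Variable R : realType.
Variables (T : Type) (D : T -> Prop) (N : T -> R).

(** Here [N] is meant to be a squared seminorm, evaluated at a parameter [t]
    that is a pair of points in the application. Leaving the constant
    existential makes the notion stable under all linear operations, so that
    no constant has to be followed through the estimates. *)
Definition dominated k (F : T -> 'cV[R]_k) :=
  exists2 C : R, 0 <= C & forall t, D t -> dotcv (F t) (F t) <= C * N t.

Lemma dominatedZ k a (F : T -> 'cV[R]_k) :
  dominated F -> dominated (fun t => a *: F t).
Proof.
move=> [C C0 FC]; exists (a ^+ 2 * C) => [|t Dt].
  by rewrite mulr_ge0 ?sqr_ge0.
rewrite dotcvZl dotcvZr mulrA -expr2 -mulrA.
by apply: ler_wpM2l; [exact: sqr_ge0 | exact: FC].
Qed.

Lemma dominatedD k (F G : T -> 'cV[R]_k) :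
  dominated F -> dominated G -> dominated (fun t => F t + G t).
Proof.
move=> [C C0 FC] [C' C'0 GC]; exists (2 * (C + C')) => [|t Dt].
  by rewrite mulr_ge0 // addr_ge0.
have := dotcv_ge0 (F t + (-1) *: G t); have := FC t Dt; have := GC t Dt.
rewrite !(dotcvDl, dotcvDr, dotcvZl, dotcvZr) (dotcvC (G t) (F t)).
lra.
Qed.

Lemma dominated_sum k (I : finType) (F : I -> T -> 'cV[R]_k) :
  (forall i, dominated (F i)) -> dominated (fun t => \sum_i F i t).
Proof.
move=> FC; elim: (index_enum I) => [|i s IH].
  exists 0 => // t _; rewrite big_nil mul0r.
  by rewrite /dotcv mulmx0 mxE.
have [C C0 E] := dominatedD (FC i) IH.
by exists C => // t Dt; rewrite big_cons; exact: E.
Qed.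
End Dominated.

(** * Boundedness and coercivity of matrices *)

Section Coercivity.
Variable R : realType.

(** Expand [A *m u] over the columns of [A]: no coordinate of [u] exceeds its
    norm in absolute value. *)
Lemma mulmx_bounded m n (A : 'M[R]_(m, n)) : exists2 C : R, 0 <= C &
  forall u, dotcv (A *m u) (A *m u) <= C * dotcv u u.
Proof.
have [|C C0 E] := @dominated_sum R _ (fun=> True) (fun u => dotcv u u) m 'I_n
    (fun j (u : 'cV[R]_n) => u j 0 *: col j A).
  move=> j; exists (dotcv (col j A) (col j A)) => [|u _].
    exact: dotcv_ge0.
  rewrite dotcvZl dotcvZr mulrA mulrC; apply: ler_wpM2l; first exact: dotcv_ge0.
  rewrite dotcvE (bigD1 j) //= lerDl sumr_ge0 // => i _.
  by rewrite -expr2 sqr_ge0.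
exists C => // u; have := E u I.
suff -> : \sum_j u j 0 *: col j A = A *m u by [].
apply/colP => i; rewrite summxE mxE; apply: eq_bigr => j _.
by rewrite !mxE mulrC.
Qed.

Lemma dominated_mulmx (T : Type) (D : T -> Prop) (N : T -> R) m n
    (A : 'M[R]_(m, n)) F :
  dominated D N F -> dominated D N (fun t => A *m F t).
Proof.
have [C C0 AC] := mulmx_bounded A => -[C' C'0 FC].
exists (C * C') => [|t Dt]; first exact: mulr_ge0.
apply: le_trans (AC _) _; rewrite -mulrA.
by apply: ler_wpM2l => //; exact: FC.
Qed.

Lemma posdef_semidef n (A : 'M[R]_n) : posdefmx A -> possemidefmx A.
Proof.
move=> [AA Apos]; split=> // x; have [->|/Apos/ltW//] := eqVneq x 0.
by rewrite mulmx0 /dotcv mulmx0 mxE.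
Qed.

Lemma posdef_unitmx n (A : 'M[R]_n) : posdefmx A -> A \in unitmx.
Proof.
move=> [AA Apos]; rewrite -row_free_unit -kermx_eq0; apply/rowV0P => v.
move=> /sub_kermxP vA; apply: contra_eq vA => v0.
have := Apos v^T; rewrite trmx_eq0 => /(_ v0).
rewrite -{1}AA -trmx_mul; apply: contraTneq => ->.
by rewrite trmx0 /dotcv mulmx0 mxE ltxx.
Qed.

Lemma posdefZ n a (A : 'M[R]_n) : 0 < a -> posdefmx A -> posdefmx (a *: A).
Proof.
move=> a0 [AA Apos]; split=> [|x /Apos]; first by rewrite linearZ /= AA.
by rewrite -scalemxAl dotcvZr pmulr_rgt0.
Qed.

Lemma possemidefZ n a (A : 'M[R]_n) :
  0 <= a -> possemidefmx A -> possemidefmx (a *: A).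
Proof.
move=> a0 [AA Apos]; split=> [|x]; first by rewrite linearZ /= AA.
by rewrite -scalemxAl dotcvZr mulr_ge0.
Qed.

Lemma posdef_invmx n (A : 'M[R]_n) : posdefmx A -> posdefmx (invmx A).
Proof.
move=> Apd; have Au := posdef_unitmx Apd; have [AA Apos] := Apd.
split=> [|x x0]; first by rewrite trmx_inv AA.
have /Apos : invmx A *m x != 0.
  by apply: contra_neq x0 => x0; rewrite -(mulKVmx Au x) x0 mulmx0.
by rewrite mulKVmx // dotcvC.
Qed.

(** With [S] the square root of [A], [u^T A u = |S u|^2], and [S] is invertible,
    so [|u|] is at most a constant times [|S u|]. *)
Lemma posdef_coercive n (A : 'M[R]_n) : posdefmx A ->
  exists2 a : R, 0 < a & forall u, a * dotcv u u <= dotcv u (A *m u).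
Proof.
move=> Apd; have [[SS _] SA] := sqrtmxP (posdef_semidef Apd).
set S := sqrtmx A in SS SA.
have : A \in unitmx by exact: posdef_unitmx.
rewrite -SA unitmx_mul => /andP[Su _].
have [C C0 SC] := mulmx_bounded (invmx S).
(* The shift by 1 guards against [C = 0]. *)
exists (C + 1)^-1 => [|u]; first by rewrite invr_gt0 ltr_wpDl.
rewrite SA (dotcv_sym_sqr _ SS SA) mulrC ler_pdivrMr ?ltr_wpDl //.
have := SC (S *m u); rewrite mulKmx // => /le_trans; apply.
by rewrite mulrC ler_wpM2l ?dotcv_ge0 // lerDl.
Qed.

(** Put [w = A^-1 u], so that [u^T A^-1 u = u^T w = w^T A w >= a |w|^2], and
    expand [0 <= |u - a w|^2]. *)
Lemma coercive_invmx n (A : 'M[R]_n) a : A \in unitmx -> 0 < a ->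
  (forall u, a * dotcv u u <= dotcv u (A *m u)) ->
  forall u, a * dotcv u (invmx A *m u) <= dotcv u u.
Proof.
move=> Au a0 Aa u; set w := invmx A *m u.
have uE : u = A *m w by rewrite mulKVmx.
have := dotcv_ge0 (u + (- a) *: w); have := Aa w.
rewrite -uE !(dotcvDl, dotcvDr, dotcvZl, dotcvZr) (dotcvC w u) => waw.
have := ler_wpM2l (ltW a0) waw; lra.
Qed.

Lemma quad_upper_bound n (A : 'M[R]_n) : exists2 C : R, 0 <= C &
  forall u, dotcv u (A *m u) <= C * dotcv u u.
Proof.
have [C C0 AC] := mulmx_bounded A.
exists (C + 1) => [|u]; first exact: addr_ge0.
have := dotcv_ge0 (u + (-1) *: (A *m u)); have := AC u.
have := dotcv_ge0 u; have := dotcv_ge0 (A *m u).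
rewrite !(dotcvDl, dotcvDr, dotcvZl, dotcvZr) (dotcvC (A *m u) u).
lra.
Qed.
End Coercivity.

(** * The coefficients of the Gramian inequalities *)

Section Gramians.
Variables (R : realType) (n m q : nat).
Variables (f : 'cV[R]_n -> 'cV[R]_n) (g : 'I_m -> 'cV[R]_n -> 'cV[R]_n).
Variables (gamma : 'I_q -> 'cV[R]_n -> 'cV[R]_n) (K : 'M[R]_q).

Lemma frobnorm_sqrtmx k (X : 'M[R]_n) (A : 'M[R]_(n, k)) :
  possemidefmx X -> frobnorm (sqrtmx X *m A) ^+ 2 = \tr (A^T *m X *m A).
Proof.
move=> /sqrtmxP[[SS _] SX].
by rewrite frobnorm_sqr trmx_mul SS !mulmxA -[_ *m _ *m sqrtmx X]mulmxA SX.
Qed.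

Lemma enorm_sqrtmx (X : 'M[R]_n) u :
  possemidefmx X -> enorm (sqrtmx X *m u) ^+ 2 = quadV X u.
Proof.
move=> /sqrtmxP[[SS _] SX].
by rewrite enorm_sqr quadVE (dotcv_sym_sqr _ SS SX).
Qed.

(** The Frobenius terms depend on [X^{1/2}] only through [X], which spares any
    comparison between the square roots of [X] and of [t *: X]. *)
Lemma LVZ (X : 'M[R]_n) t delta x y : possemidefmx X -> 0 <= t ->
  LV f g gamma K (t *: X) delta x y = t * LV f g gamma K X delta x y.
Proof.
move=> Xpsd t0; have tXpsd := possemidefZ t0 Xpsd.
rewrite /LV -!(mulmxA (sqrtmx _) _ (sqrtmx K)) !frobnorm_sqrtmx //.
by rewrite -scalemxAl dotcvZr -!scalemxAr -!scalemxAl !linearZ /=; ring.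
Qed.

Lemma UmxZ (M : 'I_q -> 'M[R]_(n, m)) (U0 : 'M[R]_m) (X : 'M[R]_n) t :
  Umx M K U0 (t *: X) =
    U0 - t *: \sum_(i < q) \sum_(j < q) K i j *: ((M i)^T *m X *m M j).
Proof.
rewrite /Umx scaler_sumr; congr (_ - _); apply: eq_bigr => i _.
rewrite scaler_sumr; apply: eq_bigr => j _.
by rewrite -scalemxAr -scalemxAl !scalerA mulrC.
Qed.

Lemma SvecZ (B : 'M[R]_(n, m)) (M : 'I_q -> 'M[R]_(n, m)) (X : 'M[R]_n) t x y :
  Svec gamma B M K (t *: X) x y = t *: Svec gamma B M K X x y.
Proof.
rewrite /Svec scalerDr scaler_sumr -scalemxAr -scalemxAl; congr (_ + _).
apply: eq_bigr => i _; rewrite scaler_sumr; apply: eq_bigr => j _.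
by rewrite -scalemxAr -scalemxAl !scalerA mulrC.
Qed.

Lemma noise_tr (M : 'I_q -> 'M[R]_(n, m)) (X : 'M[R]_n) : K^T = K -> X^T = X ->
  let W := \sum_(i < q) \sum_(j < q) K i j *: ((M i)^T *m X *m M j) in W^T = W.
Proof.
move=> KK XX; rewrite /= linear_sum /= exchange_big; apply: eq_bigr => j _ /=.
rewrite linear_sum; apply: eq_bigr => i _ /=.
by rewrite linearZ /= !trmx_mul trmxK XX mulmxA -{1}KK mxE.
Qed.

(** Every summand of [S_X] is a constant matrix applied to [X^{1/2} (x - y)] or
    to [X^{1/2} (gamma_j x - gamma_j y)]; the latter is a column of the matrix
    whose Frobenius norm is controlled by hypothesis. *)
Lemma Svec_dominated (D : 'cV[R]_n * 'cV[R]_n -> Prop) (B : 'M[R]_(n, m))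
    (M : 'I_q -> 'M[R]_(n, m)) (X : 'M[R]_n) c :
  possemidefmx X -> 0 < c ->
  (forall xy, D xy ->
     frobnorm (sqrtmx X *m (colsmx gamma xy.1 - colsmx gamma xy.2))
       <= c * enorm (sqrtmx X *m (xy.1 - xy.2))) ->
  dominated D (fun xy => quadV X (xy.1 - xy.2))
    (fun xy => Svec gamma B M K X xy.1 xy.2).
Proof.
move=> Xpsd c0 gc; have [[SS _] SX] := sqrtmxP Xpsd.
set S := sqrtmx X in SS SX gc.
have split_mul k (A : 'M[R]_(k, n)) v : A *m X *m v = A *m S *m (S *m v).
  by rewrite -SX !mulmxA.
have Sdiff : dominated D (fun xy => quadV X (xy.1 - xy.2))
    (fun xy => S *m (xy.1 - xy.2)).
  by exists 1 => // xy _; rewrite mul1r -enorm_sqr enorm_sqrtmx.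
have Sgam j : dominated D (fun xy => quadV X (xy.1 - xy.2))
    (fun xy => S *m (gamma j xy.1 - gamma j xy.2)).
  exists (c ^+ 2) => [|xy /gc]; first exact: sqr_ge0.
  set A := S *m (colsmx gamma _ - _) => Ac.
  have -> : S *m (gamma j xy.1 - gamma j xy.2) = col j A.
    by apply/colP => i; rewrite !mxE; apply: eq_bigr => k _; rewrite !mxE.
  rewrite -enorm_sqrtmx // -exprMn.
  apply: (@le_trans _ _ (frobnorm A ^+ 2)); last first.
    by rewrite lerXn2r // nnegrE ?mulr_ge0 ?sqrtr_ge0 // ltW.
  rewrite frobnorm_sqr /mxtrace (bigD1 j) //=.
  suff -> : (A^T *m A) j j = dotcv (col j A) (col j A).
    rewrite lerDl; apply: sumr_ge0 => k _; rewrite mxE.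
    by apply: sumr_ge0 => i _; rewrite mxE -expr2 sqr_ge0.
  by rewrite dotcvE mxE; apply: eq_bigr => i _; rewrite !mxE.
rewrite /Svec; apply: dominatedD.
  have [C C0 E] := dominated_mulmx (B^T *m S) Sdiff.
  by exists C => // xy Dxy; rewrite split_mul; exact: E.
apply: dominated_sum => i; apply: dominated_sum => j; apply: dominatedZ.
have [C C0 E] := dominated_mulmx ((M i)^T *m S) (Sgam j).
by exists C => // xy Dxy; rewrite split_mul; exact: E.
Qed.

(** * Existence of the Gramians over a set of pairs *)

(** The factor [t] must serve two purposes: [t * w <= a / 2] keeps
    [U0 - t W >= a / 2], and [t * C <= lambda * (a / 2)] lets the decay absorb
    [t^2 * s^T U^-1 s <= t^2 * (2 / a) * C * V]. *)
Lemma reachability_on (D : 'cV[R]_n * 'cV[R]_n -> Prop) (B : 'M[R]_(n, m))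
    (M : 'I_q -> 'M[R]_(n, m)) (U0 : 'M[R]_m) (X : 'M[R]_n) (lambda delta : R) :
  possemidefmx K -> posdefmx U0 -> posdefmx X -> 0 < lambda ->
  (forall xy, D xy -> LV f g gamma K X delta xy.1 xy.2
                        <= - lambda * quadV X (xy.1 - xy.2)) ->
  (exists2 c : R, 0 < c & forall xy, D xy ->
     frobnorm (sqrtmx X *m (colsmx gamma xy.1 - colsmx gamma xy.2))
       <= c * enorm (sqrtmx X *m (xy.1 - xy.2))) ->
  exists P : 'M[R]_n,
    [/\ posdefmx P, posdefmx (Umx M K U0 (invmx P)) &
      forall xy, D xy -> reach_ineq f g gamma B M K U0 P delta xy.1 xy.2].
Proof.
move=> Kpsd U0pd Xpd l0 LVX [c c0 gc].
have Xpsd := posdef_semidef Xpd.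
have [C C0 SC] := Svec_dominated B M Xpsd c0 gc.
have [a a0 U0a] := posdef_coercive U0pd.
have a20 : 0 < a / 2 by rewrite divr_gt0.
set W := \sum_(i < q) \sum_(j < q) K i j *: ((M i)^T *m X *m M j).
have [w w0 Ww] := quad_upper_bound W.
have [t t0 [tw tC]] : exists2 t : R, 0 < t &
    t * w <= a / 2 /\ t * C <= lambda * (a / 2).
  have la0 : 0 < lambda * (a / 2) by rewrite mulr_gt0.
  have w10 : 0 < w + 1 by rewrite ltr_wpDl.
  have C10 : 0 < C + 1 by rewrite ltr_wpDl.
  pose t := Num.min (a / 2 / (w + 1)) (lambda * (a / 2) / (C + 1)).
  have t0 : 0 < t by rewrite lt_min !divr_gt0.
  have shrink r b : 0 < r + 1 -> t <= b / (r + 1) -> t * r <= b.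
    move=> r10; rewrite ler_pdivlMr //; apply: le_trans.
    by rewrite ler_wpM2l ?(ltW t0) // lerDl.
  by exists t => //; split; apply: shrink; rewrite // ge_min lexx ?orbT.
have tXpd : posdefmx (t *: X) by exact: posdefZ.
have Ucoer u : a / 2 * dotcv u u <= dotcv u (Umx M K U0 (t *: X) *m u).
  rewrite UmxZ mulmxBl -scalemxAl -scaleN1r dotcvDr !dotcvZr.
  have := ler_wpM2l (ltW t0) (Ww u); have := ler_wpM2r (dotcv_ge0 u) tw.
  have := U0a u; rewrite -/W; lra.
have Upd : posdefmx (Umx M K U0 (t *: X)).
  split=> [|u u0].
    by rewrite UmxZ linearB /= linearZ /= noise_tr ?Xpd.1 ?Kpsd.1 ?U0pd.1.
  by apply: lt_le_trans (Ucoer u); rewrite mulr_gt0 ?divr_gt0 ?dotcv_gt0.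
exists (invmx (t *: X)); rewrite /reach_ineq invmxK; split=> //.
  exact: posdef_invmx.
move=> [x y] /= Dxy; rewrite LVZ // ?(ltW t0) // SvecZ.
have := LVX _ Dxy; have := SC _ Dxy => /=.
set s := Svec _ _ _ _ _ _ _; set V := quadV _ _ => sV LVV.
rewrite -mulmxA -/(dotcv (t *: s) _) -scalemxAr dotcvZl dotcvZr.
set U := Umx _ _ _ _ in Ucoer Upd *.
have V0 : 0 <= V by rewrite /V quadVE; exact: Xpsd.2.
have := coercive_invmx (posdef_unitmx Upd) a20 Ucoer s.
set r := dotcv s _ => rs.
suff tr : t * r <= lambda * V.
  rewrite -mulrN ler_wpM2l ?(ltW t0) //; lra.
rewrite -(ler_pM2l a20) mulrCA.
apply: (@le_trans _ _ (t * (C * V))).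
  by rewrite ler_wpM2l ?(ltW t0) //; exact: le_trans sV.
by rewrite !mulrA [a / 2 * _]mulrC ler_wpM2r.
Qed.

Lemma observability_on (D : 'cV[R]_n * 'cV[R]_n -> Prop) p
    (h : 'cV[R]_n -> 'cV[R]_p) (X : 'M[R]_n) (lambda delta : R) :
  possemidefmx X -> 0 < lambda ->
  (forall xy, D xy -> LV f g gamma K X delta xy.1 xy.2
                        <= - lambda * quadV X (xy.1 - xy.2)) ->
  (exists2 c : R, 0 < c & forall xy, D xy ->
     enorm (h xy.1 - h xy.2) <= c * enorm (sqrtmx X *m (xy.1 - xy.2))) ->
  exists2 Q : 'M[R]_n, possemidefmx Q &
    forall xy, D xy -> LV f g gamma K Q delta xy.1 xy.2
      <= - dotcv (h xy.1 - h xy.2) (h xy.1 - h xy.2).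
Proof.
move=> Xpsd l0 LVX [c c0 hc].
have t0 : 0 <= c ^+ 2 / lambda by rewrite divr_ge0 ?sqr_ge0 // ltW.
exists (c ^+ 2 / lambda *: X) => [|xy Dxy]; first exact: possemidefZ.
rewrite LVZ //; apply: le_trans (ler_wpM2l t0 (LVX _ Dxy)) _.
rewrite mulNr mulrN lerN2 mulrA divfK ?gt_eqF // -enorm_sqr -enorm_sqrtmx //.
by rewrite -exprMn lerXn2r ?nnegrE ?mulr_ge0 ?sqrtr_ge0 ?(ltW c0) // hc.
Qed.
End Gramians.

Theorem theorem3p7 (R : realType) (n m p q : nat)
    (f : 'cV[R]_n -> 'cV[R]_n) (g : 'I_m -> 'cV[R]_n -> 'cV[R]_n)
    (gamma : 'I_q -> 'cV[R]_n -> 'cV[R]_n) (h : 'cV[R]_n -> 'cV[R]_p)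
    (B : 'M[R]_(n, m)) (M : 'I_q -> 'M[R]_(n, m)) (K : 'M[R]_q)
    (U0 : 'M[R]_m)
    (f0 : f 0 = 0) (g0 : forall i, g i 0 = 0)
    (gamma0 : forall j, gamma j 0 = 0) (h0 : h 0 = 0)
    (K_psd : possemidefmx K) (U0_pd : posdefmx U0)
    (X : 'M[R]_n) (lambda delta : R)
    (X_pd : posdefmx X) (lambda_gt0 : 0 < lambda) (delta_gt0 : 0 < delta) :
  (((forall x y : 'cV[R]_n,
        LV f g gamma K X delta x y <= - lambda * quadV X (x - y)) ->
    (exists2 c : R, 0 < c & forall x y : 'cV[R]_n,
        frobnorm (sqrtmx X *m (colsmx gamma x - colsmx gamma y))
          <= c * enorm (sqrtmx X *m (x - y))) ->
    exists P : 'M[R]_n, reachability_gramian f g gamma B M K U0 P)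
   /\
   ((forall x : 'cV[R]_n,
        LV f g gamma K X delta x 0 <= - lambda * quadV X (x - 0)) ->
    (exists2 c : R, 0 < c & forall x : 'cV[R]_n,
        frobnorm (sqrtmx X *m (colsmx gamma x - colsmx gamma 0))
          <= c * enorm (sqrtmx X *m (x - 0))) ->
    exists P : 'M[R]_n, simplified_reachability_gramian f g gamma B M K U0 P))
  /\
  (((forall x y : 'cV[R]_n,
        LV f g gamma K X delta x y <= - lambda * quadV X (x - y)) ->
    (exists2 c : R, 0 < c & forall x y : 'cV[R]_n,
        enorm (h x - h y) <= c * enorm (sqrtmx X *m (x - y))) ->
    exists Q : 'M[R]_n, observability_gramian f g gamma h K Q)
   /\
   ((forall x : 'cV[R]_n,
        LV f g gamma K X delta x 0 <= - lambda * quadV X (x - 0)) ->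
    (exists2 c : R, 0 < c & forall x : 'cV[R]_n,
        enorm (h x - h 0) <= c * enorm (sqrtmx X *m (x - 0))) ->
    exists Q : 'M[R]_n, simplified_observability_gramian f g gamma h K Q)).
Proof.
split; split=> LVX [c c0 bound].
- have [||P [Ppd Upd PD]] := reachability_on (f := f) (g := g)
    (gamma := gamma) (D := fun=> True) (delta := delta)
    B M K_psd U0_pd X_pd lambda_gt0.
  + by move=> [x y] _; exact: LVX.
  + by exists c => // -[x y] _; exact: bound.
  exists P; split=> //; exists delta => // x y; exact: (PD (x, y) I).
- have [||P [Ppd Upd PD]] := reachability_on (f := f) (g := g)
    (gamma := gamma) (D := fun xy => xy.2 = 0)
    (delta := delta) B M K_psd U0_pd X_pd lambda_gt0.
  + by move=> [x y] /= ->; exact: LVX.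
  + by exists c => // -[x y] /= ->; exact: bound.
  exists P; split=> //; exists delta => // x; exact: (PD (x, 0) erefl).
- have [||Q Qpsd QD] := observability_on (f := f) (g := g)
    (gamma := gamma) (K := K) (D := fun=> True) (delta := delta)
    (h := h) (posdef_semidef X_pd) lambda_gt0.
  + by move=> [x y] _; exact: LVX.
  + by exists c => // -[x y] _; exact: bound.
  exists Q; split=> //; exists delta => // x y; exact: (QD (x, y) I).
- have [||Q Qpsd QD] := observability_on (f := f) (g := g)
    (gamma := gamma) (K := K) (D := fun xy => xy.2 = 0)
    (delta := delta) (h := h) (posdef_semidef X_pd) lambda_gt0.
  + by move=> [x y] /= ->; exact: LVX.
  + by exists c => // -[x y] /= ->; exact: bound.
  exists Q; split=> //; exists delta => // x; exact: (QD (x, 0) erefl).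
Qed.
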